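(* Let $\varepsilon>0$ and grant (NormEq) with constant $C'$ and (H) with parameters $r$ and $\alpha$. Then every $f\in F$ with $\|f-f^*\|_{L_2}\le r$ satisfies $\|f-f^*\|_{L_2}^2\le\frac4\alpha P\mathcal L_f$.
   Context: Setting: $F$ is a convex class of measurable functions $\mathcal X\to\mathbb R$, $\mathcal Y=\mathbb R$, $(X,Y)\sim P$, $X\sim\mu$, $\|g\|_{L_p}=(\mathbb E|g(X)|^p)^{1/p}$. For $\delta>0$, $\rho_H(t)=t^2/2$ if $|t|\le\delta$ and $\rho_H(t)=\delta|t|-\delta^2/2$ otherwise; the Huber loss is $\ell_f(x,y)=\rho_H(y-f(x))$. $f^*$ is the (unique) minimizer of $f\mapsto P\ell_f$ over $F$, $\mathcal L_f=\ell_f-\ell_{f^*}$, $P\mathcal L_f=\mathbb E\mathcal L_f(X,Y)$. (NormEq): there is $C'>0$ such that $\|f-f^*\|_{L_{2+\varepsilon}}\le C'\|f-f^*\|_{L_2}$ for all $f\in F$. (H): letting $F_{Y|X=x}$ be the conditional c.d.f. of $Y$ given $X=x$, there exist $\alpha>0$, $r>0$ such that for all $x\in\mathcal X$ and $z\in\mathbb R$ with $|z-f^*(x)|\le(\sqrt2C')^{(2+\varepsilon)/\varepsilon}r$, $F_{Y|X=x}(z+\delta)-F_{Y|X=x}(z-\delta)\ge\alpha$. *)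

(* Defs.v *)
From HB Require Import structures.
From mathcomp Require Import all_boot all_order all_algebra.
From mathcomp Require Import all_classical all_reals all_analysis.
Set Implicit Arguments. Unset Strict Implicit. Unset Printing Implicit Defensive.
Import Order.TTheory GRing.Theory Num.Theory.
Import numFieldNormedType.Exports.
Local Open Scope classical_set_scope.
Local Open Scope ring_scope.

Definition huber {R : realType} (delta t : R) : R :=
  if `|t| <= delta then t ^+ 2 / 2 else delta * `|t| - delta ^+ 2 / 2.

Definition huber_loss {R : realType} {d} {T : measurableType d}
  (delta : R) (f : T -> R) (z : T * R) : R := huber delta (z.2 - f z.1).

Definition excess_risk {R : realType} {d} {T : measurableType d}
  (P : {measure set (T * R) -> \bar R}) (delta : R) (fstar f : T -> R) : \bar R :=
  (\int[P]_z (huber_loss delta f z - huber_loss delta fstar z)%:E)%E.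

Definition cond_cdf {R : realType} {d} {T : measurableType d}
  (K : R.-pker T ~> R) (x : T) (t : R) : R :=
  fine (K x [set` `]-oo, t]]).

Definition convex_class {R : realType} {T : Type} (F : set (T -> R)) : Prop :=
  forall f g (l : R), F f -> F g -> 0 <= l <= 1 ->
    F (fun x => l * f x + (1 - l) * g x).

(* Main.v *)
(** For [0 < l <= 1] the function [fl = l f + (1 - l) f*] lies in F, so
    optimality of f* shows that P L_f dominates the integral of the nonnegative
    gap [rho(c - g) - rho(c) - (rho(c - l g) - rho(c)) / l], where
    [g = f(x) - f*(x)] and [c = y - f*(x)]. Up to [l g^2 / 2] this gap dominates
    the Bregman divergence [rho(c - g) - rho(c) + g rho'(c)], which is at least
    [g^2 int_0^1 (1 - t) 1{|c - t g| <= delta} dt]. Integrating in y and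
    exchanging the integrals, (H) bounds the conditional expectation of the
    divergence below by [alpha g^2 / 2] wherever [|g| <= M], with
    [M = (sqrt 2 C')^((2 + eps) / eps) r]. By (NormEq) and the choice of M, the
    set where [|g| > M] carries at most half of the squared L2 norm, since
    there [g^2 <= M^(- eps) |g|^(2 + eps)]. Finally l tends to 0; using the gap
    instead of the first-order condition at f* avoids differentiating under
    the integral. *)

Require Import Defs.
From HB Require Import structures.
From mathcomp Require Import all_boot all_order all_algebra.
From mathcomp Require Import all_classical all_reals all_analysis.
From mathcomp Require Import measurable_realfun ring lra.
Import Order.TTheory GRing.Theory Num.Theory.
Import numFieldNormedType.Exports.
Local Open Scope classical_set_scope.
Local Open Scope ring_scope.

(** * The Huber function and its Bregman divergence *)

(* The derivative of [huber delta]. *)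
Definition clip {R : realType} (delta t : R) : R :=
  Num.max (- delta) (Num.min delta t).

(* The Bregman divergence of [huber delta] from [c] to [c - g]. *)
Definition huber_bregman {R : realType} (delta c g : R) : R :=
  huber delta (c - g) - huber delta c + g * clip delta c.

(** On each of the three ranges [huber] and [clip] become polynomials, which reduces the
    inequalities below to real arithmetic. The ranges overlap at the endpoints, where the formulas
    agree. *)
Lemma huberP (R : realType) (delta t : R) : 0 < delta ->
  [\/ [/\ t <= - delta, clip delta t = - delta &
         huber delta t = - (delta * t) - delta ^+ 2 / 2],
      [/\ - delta <= t, t <= delta, clip delta t = t & huber delta t = t ^+ 2 / 2] |
      [/\ delta <= t, clip delta t = delta &
         huber delta t = delta * t - delta ^+ 2 / 2]].
Proof.
move=> d0; rewrite /clip /huber ler_norml.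
have [tl|tl] := leP t (- delta).
  apply: Or31; split=> //; first by rewrite min_r ?max_l //; lra.
  case: ifPn => [/andP[h _]|_]; last by rewrite ler0_norm; lra.
  by rewrite (_ : t = - delta); lra.
have [tr|tr] /= := leP t delta.
  apply: Or32; split; rewrite ?(ltW tl) //.
  by rewrite max_r; lra.
apply: Or33; split=> //; rewrite ?(ltW tr) //; first by rewrite max_r; lra.
by rewrite andbF ger0_norm; lra.
Qed.

(** The second derivative of [huber delta] is at most 1 where it exists. *)
Lemma huber_bregman_le (R : realType) (delta c g : R) : 0 < delta ->
  huber_bregman delta c g <= g ^+ 2 / 2.
Proof.
move=> d0; rewrite /huber_bregman.
by have [[? -> ->]|[? ? -> ->]|[? -> ->]] := huberP _ _ c d0;
  have [[? _ ->]|[? ? _ ->]|[? _ ->]] := huberP _ _ (c - g) d0; nra.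
Qed.

Lemma huber_bregman_ge0 (R : realType) (delta c g : R) : 0 < delta ->
  0 <= huber_bregman delta c g.
Proof.
move=> d0; rewrite /huber_bregman.
by have [[? -> ->]|[? ? -> ->]|[? -> ->]] := huberP _ _ c d0;
  have [[? _ ->]|[? ? _ ->]|[? _ ->]] := huberP _ _ (c - g) d0; nra.
Qed.

Lemma huber_bregmanNN (R : realType) (delta c g : R) : 0 < delta ->
  huber_bregman delta (- c) (- g) = huber_bregman delta c g.
Proof.
move=> d0; rewrite /huber_bregman /huber -opprD !normrN !sqrrN.
rewrite (_ : clip delta (- c) = - clip delta c) ?mulrNN //.
have [[? -> _]|[? ? -> _]|[? -> _]] := huberP _ _ c d0;
have [[? -> _]|[? ? -> _]|[? -> _]] := huberP _ _ (- c) d0; lra.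
Qed.

(** Two divergences based at the intermediate point [c - l * g], one towards [c] and one towards
    [c - g], are nonnegative. With weights [1 - l] and [l] their [clip] terms cancel. *)
Lemma huber_convex (R : realType) (delta c g l : R) : 0 < delta -> 0 <= l <= 1 ->
  huber delta (c - l * g) - huber delta c <= l * (huber delta (c - g) - huber delta c).
Proof.
move=> d0 /andP[l0 l1].
have := huber_bregman_ge0 R delta (c - l * g) (- (l * g)) d0.
have := huber_bregman_ge0 R delta (c - l * g) ((1 - l) * g) d0.
rewrite /huber_bregman opprK subrK.
rewrite (_ : c - l * g - (1 - l) * g = c - g); last by ring.
nra.
Qed.

(** * Integral form of the Taylor remainder *)

Lemma integral_1B (R : realType) (p q : R) : p <= q ->
  (\int[lebesgue_measure]_(t in `[p, q]) (1 - t)%:E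
     = ((q - p) - (q ^+ 2 - p ^+ 2) / 2)%:E)%E.
Proof.
rewrite le_eqVlt => /predU1P[->|pq].
  by rewrite set_itv1 integral_set1 !subrr mul0r subr0.
pose G (t : R) := t - t ^+ 2 / 2.
have dG (t : R) : is_derive t 1 G (1 - t).
  rewrite /G; apply: is_derive_eq; rewrite /GRing.scale/=.
  by rewrite /=; field.
have cG : continuous G.
  move=> t; apply: differentiable_continuous.
  apply/derivable1_diffP.
  by apply: ex_derive.
rewrite (@continuous_FTC2 _ (fun t => 1 - t) G) //.
- by rewrite -EFinB /G; congr EFin; field.
- apply: continuous_subspaceT => t.
  by apply: cvgB; [exact: cvg_cst|exact: cvg_id].
- split.
  + by move=> t _; apply: ex_derive.
  + exact/cvg_at_right_filter/cG.
  + exact/cvg_at_left_filter/cG.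
- by move=> t _; rewrite derive1E; apply: derive_val.
Qed.

(* Weight at [t] in the integral Taylor remainder of [huber delta] between [c]
   and [c - g], whose second derivative is the indicator of [[- delta, delta]]. *)
Definition window {R : realType} (delta c g t : R) : R :=
  (1 - t) * (`|c - t * g| <= delta)%R%:R.

Lemma windowNN (R : realType) (delta c g t : R) :
  window delta (- c) (- g) t = window delta c g t.
Proof. by rewrite /window mulrN -opprD normrN. Qed.

Lemma integral_window_le (R : realType) (delta c g : R) : 0 < delta ->
  ((g ^+ 2)%:E * \int[lebesgue_measure]_(t in `[0%R, 1%R]) (window delta c g t)%:E
    <= (huber_bregman delta c g)%:E)%E.
Proof.
move=> d0.
(* Changing the signs of [c] and [g] together leaves both sides unchanged. *)
wlog: c g / 0 <= g => [H|].
  have [/H//|g0] := leP 0 g.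
  have := H (- c) (- g); rewrite huber_bregmanNN // sqrrN.
  under eq_integral do rewrite windowNN.
  by apply; rewrite oppr_ge0 ltW.
rewrite le_eqVlt => /predU1P[<-|g0].
  by rewrite expr0n mul0e lee_fin huber_bregman_ge0.
(* For [0 < g], the condition [|c - t * g| <= delta] means that [t] lies between [(c - delta) / g]
   and [(c + delta) / g]; intersecting with the unit interval gives [p] and [q]. *)
pose p := Num.max 0 ((c - delta) / g).
pose q := Num.min 1 ((c + delta) / g).
have winE (t : R) : t \in `[0, 1] -> window delta c g t = (1 - t) * \1_(`[p, q]) t.
  rewrite in_itv /= => /andP[t0 t1]; rewrite /window indicE mem_setE.
  rewrite in_itv /= /p /q ge_max le_min t0 t1 ler_pdivrMr // ler_pdivlMr //=.
  rewrite ler_norml andbC; congr (_ * (nat_of_bool _)%:R).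
  by congr (_ && _); apply/idP/idP; lra.
have -> : (\int[lebesgue_measure]_(t in `[0%R, 1%R]) (window delta c g t)%:E =
    \int[lebesgue_measure]_(t in `[p, q]) (1 - t)%:E)%E.
  rewrite [in RHS](_ : [set` `[p, q]] = [set` `[0, 1]] `&` [set` `[p, q]]); last first.
    apply/esym/setIidr => t /=; rewrite !in_itv /= /p /q ge_max le_min.
    by move=> /andP[/andP[-> _] /andP[-> _]].
  rewrite integral_mkcondr; apply: eq_integral => t /[!inE] tin.
  rewrite winE // patchE indicE.
  by case: (_ \in _); rewrite ?mulr1 ?mulr0.
have [pq|qp] := leP p q; last first.
  rewrite set_itv_ge ?bnd_simp -?ltNge // integral_set0 mule0.
  by rewrite lee_fin huber_bregman_ge0.
rewrite integral_1B // -EFinM lee_fin.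
(* In terms of [g * p] and [g * q] the divisions by [g] disappear, leaving a piecewise polynomial
   inequality. *)
have -> : g ^+ 2 * (q - p - (q ^+ 2 - p ^+ 2) / 2) =
  g * (g * q - g * p) - ((g * q) ^+ 2 - (g * p) ^+ 2) / 2 by field.
have : g * p <= g * q by rewrite ler_pM2l.
have -> : g * p = Num.max 0 (c - delta).
  by rewrite /p maxr_pMr ?(ltW g0) // mulr0 mulrCA mulfV ?mulr1 // gt_eqF.
have -> : g * q = Num.min g (c + delta).
  by rewrite /q minr_pMr ?(ltW g0) // mulr1 mulrCA mulfV ?mulr1 // gt_eqF.
rewrite /huber_bregman.
have [[? -> ->]|[? ? -> ->]|[? -> ->]] := huberP _ _ c d0;
have [[? _ ->]|[? ? _ ->]|[? _ ->]] := huberP _ _ (c - g) d0;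
case: (leP 0 (c - delta)) => ?; case: (leP g (c + delta)) => ? ?; nra.
Qed.

(** * Disintegration of the joint law *)

(* The law of [(x, Y)] when [Y] has law [K x]; composing it with the constant
   kernel [mu] yields [P], whence the disintegration. *)
Definition graph_kernel {R : realType} {d d'} {T : measurableType d} {U : measurableType d'}
  (K : R.-pker T ~> U) (z : unit * T) : {measure set (T * U) -> \bar R} :=
  @measure_function_pushforward__canonical__measure_function_Measure _ _ _ _ _ (K z.2)
    (pair z.2) (pair1_measurable z.2).

Lemma measurable_graph_kernel {R : realType} {d d'} {T : measurableType d}
  {U : measurableType d'} (K : R.-pker T ~> U) (A : set (T * U)) : measurable A ->
  measurable_fun [set: unit * T] (graph_kernel K ^~ A : _ -> \bar R).
Proof.
move=> mA.
have := measurableT_comp (measurable_fun_xsection_finite_kernel K (mem_set mA)) measurable_snd.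
move=> /(_ _ unit); apply: eq_measurable_fun => -[[] x] _ /=.
by rewrite /pushforward xsectionE.
Qed.

HB.instance Definition _ {R : realType} {d d'} {T : measurableType d}
  {U : measurableType d'} (K : R.-pker T ~> U) :=
  isKernel.Build _ _ _ _ R (graph_kernel K) (measurable_graph_kernel K).

Lemma graph_kernel_setT {R : realType} {d d'} {T : measurableType d}
  {U : measurableType d'} (K : R.-pker T ~> U) z : graph_kernel K z [set: T * U] = 1%E.
Proof. by rewrite /= /pushforward preimage_setT prob_kernel. Qed.

HB.instance Definition _ {R : realType} {d d'} {T : measurableType d}
  {U : measurableType d'} (K : R.-pker T ~> U) :=
  Kernel_isProbability.Build _ _ _ _ R (graph_kernel K) (graph_kernel_setT K).

(** The hypothesis identifies [P] with the composed kernel on measurable rectangles, a generating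
    class stable under intersection, hence everywhere. The integral against a composed kernel is
    then an iterated integral. *)
Lemma integral_disintegration {R : realType} {d d'} {T : measurableType d}
  {U : measurableType d'} (P : probability (T * U)%type R) (mu : probability T R)
  (K : R.-pker T ~> U) (f : T * U -> \bar R) :
  (forall A B, measurable A -> measurable B ->
    P (A `*` B) = (\int[mu]_(x in A) K x B)%E) ->
  (forall z, (0 <= f z)%E) -> measurable_fun [set: T * U] f ->
  (\int[P]_z f z = \int[mu]_x \int[K x]_y f (x, y))%E.
Proof.
move=> PK f0 mf.
pose m : R.-pker unit ~> T := kprobability (measurable_cst (mu : pprobability T R)).
transitivity (\int[mkcomp m (graph_kernel K) tt]_z f z)%E.
  apply: eq_measure_integral => A mA _.
  apply: (measure_unique [set A `*` B | A in measurable & B in measurable]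
    (fun=> setT)) => //.
  - exact: measurable_prod_measurableType.
  - move=> _ _ [A1 mA1 [B1 mB1 <-]] [A2 mA2 [B2 mB2 <-]].
    by exists (A1 `&` A2); [exact: measurableI|exists (B1 `&` B2);
      [exact: measurableI|rewrite setXI]].
  - by move=> _; exists setT => //; exists setT => //; rewrite setXTT.
  - by rewrite bigcup_const.
  - move=> _ [A1 mA1 [B1 mB1 <-]]; apply: etrans (PK _ _ mA1 mB1) _.
    rewrite /mkcomp /= /kcomp /= integral_mkcond.
    apply: eq_integral => x _; rewrite /pushforward /patch /=.
    have -> : pair x @^-1` (A1 `*` B1) = xsection (A1 `*` B1) x by rewrite xsectionE.
    case: ifPn => xA1; first by rewrite in_xsectionX.
    by rewrite notin_xsectionX // measure0.
  - by move=> _; apply: le_lt_trans (probability_le1 P measurableT) _; rewrite ltry.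
rewrite (@integral_kcomp _ _ _ _ _ _ _ m (graph_kernel K) tt f f0 mf).
apply: eq_integral => x _.
by rewrite ge0_integral_pushforward.
Qed.

(** * Lower bound for the conditional mean of the divergence *)

Lemma measurable_huber (R : realType) (delta : R) :
  measurable_fun [set: R] (huber delta).
Proof.
apply: measurable_fun_if => //.
- by apply: measurable_fun_ler => //; exact: normr_measurable.
- by apply: measurable_funTS; apply: measurable_funM => //; exact: exprn_measurable.
- apply: measurable_funTS; apply: measurable_funB => //.
  by apply: measurable_funM => //; exact: normr_measurable.
Qed.

Lemma measurable_huber_bregman (R : realType) (delta g : R) :
  measurable_fun [set: R] (huber_bregman delta ^~ g).
Proof.
apply: measurable_funD; last first.
  apply: measurable_funM => //; apply: measurable_maxr => //.
  exact: measurable_minr.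
apply: measurable_funB; last exact: measurable_huber.
by apply: (measurableT_comp (measurable_huber _ _)); exact: measurable_funB.
Qed.

(** Subadditivity applies because the half-line up to [b] is covered by the half-line up to [a] and
    the closed interval. The interval is closed to match [window]. *)
Lemma cdf_window_le (R : realType) (kappa : probability R R) (a b alpha : R) :
  alpha <= fine (kappa [set` `]-oo, b]]) - fine (kappa [set` `]-oo, a]]) ->
  (alpha%:E <= kappa [set` `[a, b]])%E.
Proof.
move=> h.
have k_fin (S : set R) : measurable S -> exists p, kappa S = p%:E.
  by move=> mS; exists (fine (kappa S)); rewrite fineK // fin_num_measure.
have [p kab] := k_fin [set` `[a, b]] (measurable_itv _).
have [pa ka] := k_fin [set` `]-oo, a]] (measurable_itv _).
have [pb kb] := k_fin [set` `]-oo, b]] (measurable_itv _).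
have : (kappa [set` `]-oo, b]] <= kappa ([set` `[a, b]] `|` [set` `]-oo, a]]))%E.
  apply: le_measure; rewrite ?inE //; first exact: measurableU.
  move=> y /=; rewrite !in_itv /= => yb.
  by have [ya|ya] := leP y a; [right|left; rewrite (ltW ya)].
have : (kappa ([set` `[a, b]] `|` [set` `]-oo, a]]) <=
    kappa [set` `[a, b]] + kappa [set` `]-oo, a]])%E by exact: measureU2.
move=> + k_le => /(le_trans k_le).
by move: h; rewrite kab ka kb -EFinD !lee_fin /=; lra.
Qed.

Lemma measurable_window (R : realType) (delta v g : R) :
  measurable_fun [set: R * R]
    (fun z : R * R => window delta (z.1 - v) g z.2 * \1_[set` `[0, 1]] z.2).
Proof.
apply: measurable_funM; last first.
  by apply: measurableT_comp => //; exact: measurable_indic.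
apply: measurable_funM; first exact: measurable_funB.
apply: (measurableT_comp (f := fun b : bool => (nat_of_bool b)%:R : R)) => //.
apply: measurable_fun_ler => //; apply: measurableT_comp => //.
apply: measurable_funB; first exact: measurable_funB.
exact: measurable_funM.
Qed.

Lemma integral_huber_bregman_ge (R : realType) (kappa : probability R R)
    (delta alpha v g : R) : 0 < delta -> 0 < alpha ->
  (forall z, `|z - v| <= `|g| ->
    alpha <= fine (kappa [set` `]-oo, z + delta]]) - fine (kappa [set` `]-oo, z - delta]])) ->
  ((alpha * (g ^+ 2 / 2))%:E <= \int[kappa]_y (huber_bregman delta (y - v) g)%:E)%E.
Proof.
move=> d0 a0 H.
(* The indicator extends the integrand by zero to all real [t], so that Tonelli applies on the whole
   product. *)
pose W (z : R * R) := (window delta (z.1 - v) g z.2 * \1_[set` `[0, 1]] z.2)%:E.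
have W0 z : (0 <= W z)%E.
  rewrite lee_fin indicE; have [|_] := boolP (_ \in _); last by rewrite mulr0.
  by rewrite inE /= in_itv /= => /andP[_ t1]; rewrite !mulr_ge0 // subr_ge0.
have mW : measurable_fun [set: R * R] W.
  rewrite /W; apply/measurable_EFinP. exact: measurable_window.
have intW c : (\int[lebesgue_measure]_(t in `[0%R, 1%R]) (window delta c g t)%:E
    = \int[lebesgue_measure]_t (window delta c g t * \1_[set` `[0%R, 1%R]] t)%:E)%E.
  rewrite integral_mkcond; apply: eq_integral => t _.
  by rewrite patchE indicE; case: (_ \in _); rewrite ?mulr1 ?mulr0.
apply: (@le_trans _ _ (\int[kappa]_y ((g ^+ 2)%:E * \int[lebesgue_measure]_t W (y, t)))%E); last first.
  apply: ge0_le_integral => //.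
  - by move=> y _; rewrite mule_ge0 ?lee_fin ?sqr_ge0 // integral_ge0.
  - apply: measurable_funeM.
    exact: (measurable_fun_fubini_tonelli_F (m2 := lebesgue_measure) W mW W0).
  - apply/measurable_EFinP.
    apply: (measurableT_comp (measurable_huber_bregman R delta g)).
    exact: measurable_funB.
  - by move=> y _; have := integral_window_le _ _ (y - v) g d0; rewrite intW.
rewrite ge0_integralZl_EFin ?sqr_ge0 //; last 2 first.
- by move=> y _; exact: integral_ge0.
- exact: (measurable_fun_fubini_tonelli_F (m2 := lebesgue_measure) W mW W0).
have -> : (\int[kappa]_y \int[lebesgue_measure]_t W (y, t) =
    \int[lebesgue_measure]_t \int[kappa]_y W (y, t))%E.
  exact: (fubini_tonelli (m1 := kappa) (m2 := lebesgue_measure) W mW W0).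
have -> : (alpha * (g ^+ 2 / 2))%:E = ((g ^+ 2)%:E * (alpha / 2)%:E)%E.
  by rewrite -EFinM; congr EFin; field.
apply: lee_wpmul2l; rewrite ?lee_fin ?sqr_ge0 //.
(* Since [1 - t] has integral 1/2 over the unit interval, a comparison for each fixed [t]
   suffices. *)
have -> : ((alpha / 2)%:E = \int[lebesgue_measure]_(t in `[0%R, 1%R]) (alpha%:E * (1 - t)%:E))%E.
  rewrite ge0_integralZl_EFin ?(ltW a0) //; last 2 first.
  - by move=> t /=; rewrite in_itv /= lee_fin subr_ge0 => /andP[].
  - by apply/measurable_EFinP; apply: measurable_funTS; exact: measurable_funB.
  by rewrite integral_1B // -EFinM; congr EFin; field.
rewrite integral_mkcond; apply: ge0_le_integral => //.
- move=> t _; rewrite patchE; case: ifPn => //.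
  by rewrite inE /= in_itv /= => /andP[_ t1]; rewrite mule_ge0 ?lee_fin ?subr_ge0 // ltW.
- apply: (measurable_restrictT _ _).1 => //; apply: measurable_funeM.
  by apply/measurable_EFinP; apply: measurable_funTS; exact: measurable_funB.
- exact: (measurable_fun_fubini_tonelli_G (m1 := kappa) W mW W0).
move=> t _; rewrite patchE; case: ifPn => [|_]; last exact: integral_ge0.
rewrite inE /= in_itv /= => /andP[t0 t1].
(* For fixed [t], the window is the set of [y] within [delta] of this [z], and
   [|z - v| = t * |g| <= |g|]. *)
pose z := v + t * g.
have -> : (\int[kappa]_y W (y, t) =
    \int[kappa]_y ((1 - t)%:E * (\1_[set` `[z - delta, z + delta]] y)%:E))%E.
  apply: eq_integral => y _; rewrite -EFinM /W /window /= !indicE.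
  rewrite (_ : t \in _); last by rewrite inE /= in_itv /= t0.
  rewrite mulr1 mem_setE in_itv /= ler_norml; congr (_ * (nat_of_bool _)%:R)%:E.
  by congr (_ && _); rewrite /z; apply/idP/idP; lra.
rewrite ge0_integralZl_EFin ?subr_ge0 //; last exact/measurable_EFinP/measurable_indic.
rewrite integral_indic // setIT muleC; apply: lee_wpmul2l.
  by rewrite lee_fin subr_ge0.
apply/cdf_window_le/H.
by rewrite /z addrC addKr normrM ger0_norm // ler_piMl.
Qed.

(** * Truncation of the second moment *)

Lemma powR_2D (R : realType) (x eps : R) : 0 <= x -> 0 < eps ->
  x `^ (2 + eps) = x ^+ 2 * x `^ eps.
Proof.
move=> x0 e0; rewrite powRD; last by apply/implyP => /eqP; lra.
by rewrite (powR_mulrn 2).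
Qed.

Lemma measurable_le_norm d (T : measurableType d) (R : realType) (g : T -> R) (M : R) :
  measurable_fun [set: T] g -> measurable [set x | `|g x| <= M].
Proof.
move=> mg; rewrite -[X in measurable X]setTI.
have := measurable_fun_ler (measurableT_comp (@normr_measurable _ setT) mg) (measurable_cst M).
by move=> /(_ measurableT [set true]); apply.
Qed.

Lemma integral_truncated_sqr_ge d (T : measurableType d) (R : realType)
    (mu : {measure set T -> \bar R}) (g : T -> R) (eps C r h : R) :
  0 < eps -> 0 < C -> 0 < r -> 0 <= h <= r -> measurable_fun [set: T] g ->
  ('N[mu]_(2%:E)[EFin \o g] = h%:E)%E ->
  ('N[mu]_((2 + eps)%:E)[EFin \o g] <= C%:E * h%:E)%E ->
  ((h ^+ 2 / 2)%:E <= \int[mu]_(x in [set x | (`|g x| <=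
     (Num.sqrt 2 * C) `^ ((2 + eps) / eps) * r)%R]) (g x ^+ 2)%:E)%E.
Proof.
move=> e0 C0 r0 /andP[h0 hr] mg N2 Np.
set M := _ * r; set A := [set x | _].
have mA : measurable A by exact: measurable_le_norm.
have mg2 : measurable_fun [set: T] (fun x => (g x ^+ 2)%:E).
  exact/measurable_EFinP/measurable_funX.
have H2 : (\int[mu]_x (g x ^+ 2)%:E = (h ^+ 2)%:E)%E.
  have n2 : (2 : R) != 0 by rewrite pnatr_eq0.
  have := poweR_Lnorm mu (EFin \o g) n2; rewrite N2.
  rewrite poweR_EFin (powR_mulrn 2) // => ->.
  apply: eq_integral => x _ /=.
  by rewrite (powR_mulrn 2) // real_normK // num_real.
have M0 : 0 < M by rewrite mulr_gt0 // powR_gt0 // mulr_gt0 // sqrtr_gt0.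
pose k := C `^ (2 + eps) * r `^ eps.
have k0 : 0 < k by rewrite mulr_gt0 ?powR_gt0.
(* The exponent [(2 + eps) / eps] is chosen so that [M] to the power [eps] equals [2 * k] times
   [sqrt 2] to the power [eps], a factor at least 1. *)
have Mk : 2 * k <= M `^ eps.
  rewrite /M powRM ?powR_ge0 ?(ltW r0) // -powRrM.
  rewrite (_ : (2 + eps) / eps * eps = 2 + eps); last by field; rewrite gt_eqF.
  rewrite powRM ?sqrtr_ge0 ?(ltW C0) // powR_2D ?sqrtr_ge0 // sqr_sqrtr //.
  rewrite /k -!mulrA ler_pM2l // ler_peMl ?mulr_ge0 ?powR_ge0 //.
  have s1 : 1 <= Num.sqrt 2 :> R by rewrite -{1}sqrtr1 ler_sqrt ?ler1n.
  apply: (@le_trans _ _ (1 `^ eps)); first by rewrite powR1.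
  by rewrite ge0_ler_powR ?nnegrE ?(ltW e0) // sqrtr_ge0.
(* Off [A], [2 * k] is at most [|g|] to the power [eps], so the left side is at most the moment of
   order [2 + eps]. The norm comparison and [h <= r] bound that moment by [k * h ^+ 2]. *)
have tail : ((2 * k)%:E * \int[mu]_(x in ~` A) (g x ^+ 2)%:E <= (k * h ^+ 2)%:E)%E.
  rewrite -(ge0_integralZl_EFin _ (measurableC mA)); last 3 first.
  - by move=> x _; rewrite lee_fin sqr_ge0.
  - exact: measurable_funTS.
  - by rewrite mulr_ge0 // ltW.
  have mgp : measurable_fun [set: T] (fun x => (`|g x| `^ (2 + eps))%:E).
    apply/measurable_EFinP; apply: (measurableT_comp (measurable_powR _)).
    exact: measurableT_comp.
  apply: (@le_trans _ _ (\int[mu]_(x in ~` A) (`|g x| `^ (2 + eps))%:E)%E).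
    apply: ge0_le_integral.
    - exact: measurableC.
    - by move=> x _; rewrite mule_ge0 ?lee_fin ?sqr_ge0 // mulr_ge0 // ltW.
    - by apply: measurable_funeM; exact: measurable_funTS.
    - exact: measurable_funTS.
    - move=> x /negP; rewrite -ltNge => Mg; rewrite -EFinM lee_fin.
      rewrite powR_2D // real_normK ?num_real // mulrC.
      apply: ler_wpM2l; first exact: sqr_ge0.
      apply: le_trans Mk _.
      by rewrite ge0_ler_powR ?nnegrE ?(ltW e0) // ltW.
  apply: (@le_trans _ _ (\int[mu]_x (`|g x| `^ (2 + eps))%:E)%E).
    apply: ge0_subset_integral => //; first exact: measurableC.
  have e2 : 2 + eps != 0 by rewrite gt_eqF // addr_gt0.
  have := poweR_Lnorm mu (EFin \o g) e2.
  rewrite [X in _ = X](eq_integral (fun x => (`|g x| `^ (2 + eps))%:E)) //.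
  move=> <-; apply: (@le_trans _ _ ((C%:E * h%:E) `^ (2 + eps))%E).
    apply: gt0_ler_poweR => //; rewrite ?addr_ge0 ?(ltW e0) //.
    - by rewrite in_itv /= Lnorm_ge0 leey.
    - by rewrite in_itv /= leey andbT -EFinM lee_fin mulr_ge0 // ltW.
  rewrite -EFinM poweR_EFin lee_fin powRM ?(ltW C0) // [h `^ _]powR_2D //.
  rewrite /k -[leRHS]mulrA; apply: ler_wpM2l; rewrite ?powR_ge0 // [leRHS]mulrC.
  apply: ler_wpM2l; rewrite ?sqr_ge0 //.
  by rewrite ge0_ler_powR ?nnegrE ?(ltW e0) // ltW.
have split2 : ((h ^+ 2)%:E = \int[mu]_(x in A) (g x ^+ 2)%:E
    + \int[mu]_(x in ~` A) (g x ^+ 2)%:E)%E.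
  rewrite -H2 -ge0_integral_setU ?setUv //.
  - exact: measurableC.
  - by move=> x _; rewrite lee_fin sqr_ge0.
  - exact/disj_setPCl.
have IA0 : (0 <= \int[mu]_(x in A) (g x ^+ 2)%:E)%E.
  by apply: integral_ge0 => x _; rewrite lee_fin sqr_ge0.
have IB0 : (0 <= \int[mu]_(x in ~` A) (g x ^+ 2)%:E)%E.
  by apply: integral_ge0 => x _; rewrite lee_fin sqr_ge0.
move: IA0 IB0 tail split2.
case: (\int[mu]_(x in A) _)%E => [a||] //; case: (\int[mu]_(x in ~` A) _)%E => [b||] //.
rewrite -EFinM -EFinD !lee_fin => a0 b0 tail [split2].
have : 2 * b <= h ^+ 2 by rewrite -(ler_pM2l k0) mulrCA mulrA.
lra.
Qed.

(** * The convexity gap *)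

Definition convexity_gap {R : realType} (delta l c g : R) : R :=
  huber delta (c - g) - huber delta c
  - l^-1 * (huber delta (c - l * g) - huber delta c).

Lemma convexity_gap_ge0 (R : realType) (delta l c g : R) : 0 < delta ->
  0 < l <= 1 -> 0 <= convexity_gap delta l c g.
Proof.
move=> d0 /andP[l0 l1]; rewrite subr_ge0 ler_pdivrMl //.
by apply: huber_convex; rewrite // (ltW l0).
Qed.

(** This is the quadratic upper bound on the divergence for the step [l * g], divided by [l]. *)
Lemma huber_bregman_le_gap (R : realType) (delta l c g : R) : 0 < delta -> 0 < l ->
  huber_bregman delta c g <= convexity_gap delta l c g + l * (g ^+ 2 / 2).
Proof.
move=> d0 l0; have := huber_bregman_le _ delta c (l * g) d0.
rewrite /convexity_gap /huber_bregman; set u := huber _ _; set v := huber _ _.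
have -> : (l * g) ^+ 2 / 2 = l * (l * (g ^+ 2 / 2)) by field.
have -> : u - v + l * g * clip delta c = l * (l^-1 * (u - v) + g * clip delta c).
  by field; rewrite gt_eqF.
by rewrite ler_pM2l //; lra.
Qed.

Lemma measurable_convexity_gap {d} (T : measurableType d) (R : realType)
    (delta l : R) (a g : T -> R) :
  measurable_fun [set: T] a -> measurable_fun [set: T] g ->
  measurable_fun [set: T * R] (fun z => convexity_gap delta l (z.2 - a z.1) (g z.1)).
Proof.
move=> ma mg.
have mc : measurable_fun [set: T * R] (fun z : T * R => z.2 - a z.1).
  by apply: measurable_funB => //; exact: measurableT_comp.
have mg1 : measurable_fun [set: T * R] (fun z : T * R => g z.1).
  exact: measurableT_comp.
have mh (u : T * R -> R) : measurable_fun [set: T * R] u ->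
    measurable_fun [set: T * R] (fun z => huber delta (u z)).
  by move=> mu; exact: measurableT_comp (measurable_huber _ _) mu.
apply: measurable_funB; first by apply: measurable_funB; apply: mh => //; exact: measurable_funB.
apply: measurable_funM => //.
apply: measurable_funB; apply: mh => //.
by apply: measurable_funB => //; exact: measurable_funM.
Qed.

(** * From the conditional bound to the excess risk *)

(* An alias of [K x] serving as a key for its [probability] structure. *)
Definition kernel_law {R : realType} {d d'} {T : measurableType d} {U : measurableType d'}
  (K : R.-pker T ~> U) (x : T) : set U -> \bar R := K x.

HB.instance Definition _ {R : realType} {d d'} {T : measurableType d}
  {U : measurableType d'} (K : R.-pker T ~> U) (x : T) :=
  isMeasure.Build _ _ _ (kernel_law K x) (measure0 (K x)) (measure_ge0 (K x))
    (@measure_semi_sigma_additive _ _ _ (K x)).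

HB.instance Definition _ {R : realType} {d d'} {T : measurableType d}
  {U : measurableType d'} (K : R.-pker T ~> U) (x : T) :=
  Measure_isProbability.Build _ _ _ (kernel_law K x) (prob_kernel x).

Lemma kernel_integral_gap_ge {R : realType} {d} {T : measurableType d}
    (K : R.-pker T ~> R) (x : T) (delta alpha l v g : R) :
  0 < delta -> 0 < l -> l <= alpha -> l <= 1 ->
  (forall z, `|z - v| <= `|g| ->
    alpha <= cond_cdf K x (z + delta) - cond_cdf K x (z - delta)) ->
  (((alpha - l) * (g ^+ 2 / 2))%:E <=
    \int[K x]_y (convexity_gap delta l (y - v) g)%:E)%E.
Proof.
move=> d0 l0 la l1 H.
pose kappa : probability R R := kernel_law K x.
have := integral_huber_bregman_ge R kappa delta alpha v g d0 (lt_le_trans l0 la) H.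
have mgap : measurable_fun [set: R] (fun y => (convexity_gap delta l (y - v) g)%:E).
  apply/measurable_EFinP.
  have := @measurable_convexity_gap _ R R delta l (cst v) (cst g)
    (measurable_cst _) (measurable_cst _).
  by move=> /measurableT_comp/(_ (pair1_measurable (0 : R))).
have gap0 y : (0 <= (convexity_gap delta l (y - v) g)%:E)%E.
  by rewrite lee_fin convexity_gap_ge0 // l0.
have q0 : 0 <= l * (g ^+ 2 / 2) by rewrite mulr_ge0 ?(ltW l0) // divr_ge0 ?sqr_ge0.
move=> B_ge.
have : (\int[kappa]_y (huber_bregman delta (y - v) g)%:E <=
    \int[kappa]_y (convexity_gap delta l (y - v) g)%:E + (l * (g ^+ 2 / 2))%:E)%E.
  (* The constant [l * (g ^+ 2 / 2)] becomes its own integral against the probability [kappa], so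
     the bound can be checked pointwise in [y]. *)
  rewrite -[X in (_ <= _ + X)%E]mule1 -(probability_setT kappa) -integral_cst //.
  rewrite -ge0_integralD //.
  apply: ge0_le_integral => //.
  - by move=> y _; rewrite lee_fin huber_bregman_ge0.
  - apply/measurable_EFinP.
    apply: (measurableT_comp (measurable_huber_bregman R delta g)).
    exact: measurable_funB.
  - exact: emeasurable_funD.
  - by move=> y _; rewrite -EFinD lee_fin huber_bregman_le_gap.
move=> /(le_trans B_ge); rewrite -leeBlDr // -EFinB.
by congr (_%:E <= _)%E; ring.
Qed.

Lemma excess_risk_ge {R : realType} {d} {T : measurableType d}
    (P : probability (T * R)%type R) (mu : probability T R) (K : R.-pker T ~> R)
    (fstar f : T -> R) (delta alpha l M : R) :
  0 < delta -> 0 < l -> l <= alpha -> l <= 1 ->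
  measurable_fun [set: T] fstar -> measurable_fun [set: T] f ->
  (forall (A : set T) (B : set R), measurable A -> measurable B ->
     P (A `*` B) = (\int[mu]_(x in A) K x B)%E) ->
  let fl x := l * f x + (1 - l) * fstar x in
  P.-integrable [set: T * R] (EFin \o huber_loss delta f) ->
  P.-integrable [set: T * R] (EFin \o huber_loss delta fstar) ->
  P.-integrable [set: T * R] (EFin \o huber_loss delta fl) ->
  (\int[P]_z (huber_loss delta fstar z)%:E <= \int[P]_z (huber_loss delta fl z)%:E)%E ->
  (forall (x : T) (z : R), `|z - fstar x| <= M ->
     alpha <= cond_cdf K x (z + delta) - cond_cdf K x (z - delta)) ->
  (((alpha - l) / 2)%:E *
     \int[mu]_(x in [set x | (`|f x - fstar x| <= M)%R]) ((f x - fstar x) ^+ 2)%:E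
   <= excess_risk P delta fstar f)%E.
Proof.
move=> d0 l0 la l1 ms mf PK fl intf ints intl opt H.
pose g x := f x - fstar x.
have mg : measurable_fun [set: T] g by exact: measurable_funB.
pose gap (z : T * R) := (convexity_gap delta l (z.2 - fstar z.1) (g z.1))%:E.
have gap0 z : (0 <= gap z)%E by rewrite lee_fin convexity_gap_ge0 // l0.
have mgap : measurable_fun [set: T * R] gap.
  by rewrite /gap; apply/measurable_EFinP; exact: measurable_convexity_gap.
have gapE z : (gap z = (huber_loss delta f z - huber_loss delta fstar z)%:E -
    (l^-1)%:E * (huber_loss delta fl z - huber_loss delta fstar z)%:E)%E.
  rewrite -EFinM -EFinB /gap /convexity_gap /huber_loss /fl /g.
  rewrite (_ : z.2 - fstar z.1 - (f z.1 - fstar z.1) = z.2 - f z.1); last by ring.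
  by rewrite (_ : z.2 - fstar z.1 - l * (f z.1 - fstar z.1)
    = z.2 - (l * f z.1 + (1 - l) * fstar z.1)) //; ring.
pose A := [set x | `|g x| <= M].
have mA : measurable A by exact: measurable_le_norm.
pose Df z := (huber_loss delta f z - huber_loss delta fstar z)%:E.
pose Dl z := (huber_loss delta fl z - huber_loss delta fstar z)%:E.
have intDf : P.-integrable [set: T * R] Df by exact: (integrableB measurableT intf ints).
have intDl : P.-integrable [set: T * R] Dl by exact: (integrableB measurableT intl ints).
have intDl' : P.-integrable [set: T * R] (fun z => (l^-1)%:E * Dl z)%E.
  exact: integrableZl.
(* Optimality of [fstar] against [fl] enters here; the term subtracted in [gapE] then has
   nonnegative integral. *)
have Dl_ge0 : (0 <= \int[P]_z Dl z)%E.
  rewrite /Dl (integralB_EFin measurableT intl ints) sube_ge0 //.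
  by apply/orP; left; exact: (integrable_fin_num measurableT ints).
have risk_ge : (\int[P]_z gap z <= excess_risk P delta fstar f)%E.
  rewrite (eq_integral (fun z => Df z - (l^-1)%:E * Dl z)%E) => [|z _]; last exact: gapE.
  rewrite integralB // integralZl // leeBlDr; last first.
    by rewrite fin_numM // integrable_fin_num.
  by rewrite leeDl // mule_ge0 // lee_fin invr_ge0 ltW.
apply: le_trans risk_ge.
rewrite (integral_disintegration P mu K gap) //.
have mK : measurable_fun [set: T] (fun x => \int[K x]_y gap (x, y))%E.
  exact: measurable_fun_integral_finite_kernel.
(* The gap is nonnegative, so discarding the complement of [A] only lowers the integral. *)
apply: (@le_trans _ _ (\int[mu]_(x in A) \int[K x]_y gap (x, y))%E); last first.
  by apply: ge0_subset_integral => // x _; exact: integral_ge0.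
rewrite -ge0_integralZl_EFin //; last 3 first.
- by move=> x _; rewrite lee_fin sqr_ge0.
- by apply: measurable_funTS; apply/measurable_EFinP/measurable_funX.
- by rewrite divr_ge0 // subr_ge0.
apply: ge0_le_integral => //.
- by move=> x _; rewrite mule_ge0 // lee_fin ?sqr_ge0 // divr_ge0 // subr_ge0.
- by apply: measurable_funeM; apply: measurable_funTS; apply/measurable_EFinP/measurable_funX.
- exact: measurable_funTS.
- move=> x Ax.
  have -> : (((alpha - l) / 2)%:E * ((f x - fstar x) ^+ 2)%:E
      = ((alpha - l) * (g x ^+ 2 / 2))%:E)%E.
    by rewrite -EFinM; congr EFin; rewrite /g; field.
  apply: (kernel_integral_gap_ge K x delta alpha l (fstar x) (g x)) => // z zx.
  by apply: H; exact: le_trans zx Ax.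
Qed.

(** * Combination of the bounds and passage to the limit in [l] *)

Theorem theorem7 (R : realType) (d : measure_display) (T : measurableType d)
  (P : probability (T * R)%type R) (mu : probability T R) (K : R.-pker T ~> R)
  (F : set (T -> R)) (fstar : T -> R) (delta eps C' alpha r : R) :
  0 < delta -> 0 < eps -> 0 < C' -> 0 < alpha -> 0 < r ->
  convex_class F ->
  (forall f, F f -> measurable_fun [set: T] f) ->
  (* (X,Y) ~ P, X ~ mu, and K is the conditional law of Y given X *)
  (forall (A : set T) (B : set R), measurable A -> measurable B ->
     P (A `*` B) = (\int[mu]_(x in A) K x B)%E) ->
  (* the risks P l_f are finite on F *)
  (forall f, F f -> P.-integrable [set: T * R] (EFin \o huber_loss delta f)) ->
  (* f* minimizes f |-> P l_f over F *)
  F fstar ->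
  (forall f, F f -> (\int[P]_z (huber_loss delta fstar z)%:E
                     <= \int[P]_z (huber_loss delta f z)%:E)%E) ->
  (* (NormEq) *)
  (forall f, F f ->
     ('N[mu]_((2 + eps)%:E)[EFin \o (fun x => f x - fstar x)%R]
      <= C'%:E * 'N[mu]_(2%:E)[EFin \o (fun x => f x - fstar x)%R])%E) ->
  (* (H) *)
  (forall (x : T) (z : R),
     `|z - fstar x| <= (Num.sqrt 2 * C') `^ ((2 + eps) / eps) * r ->
     alpha <= cond_cdf K x (z + delta) - cond_cdf K x (z - delta)) ->
  forall f, F f ->
    ('N[mu]_(2%:E)[EFin \o (fun x => f x - fstar x)%R] <= r%:E)%E ->
    (('N[mu]_(2%:E)[EFin \o (fun x => f x - fstar x)%R]) ^+ 2
      <= (4 / alpha)%:E * excess_risk P delta fstar f)%E.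
Proof.
move=> d0 e0 C0 a0 r0 convF mF PK intF Fs opt normEq H f Ff.
set N := 'N[mu]_(2%:E)[_]%E => Nr.
have [h Nh] : exists h, N = h%:E.
  exists (fine N); rewrite fineK // fin_numE.
  by rewrite gt_eqF ?(lt_le_trans _ (Lnorm_ge0 _ _ _)) ?ltNye //= lt_eqF // (le_lt_trans Nr) ?ltry.
have h0 : 0 <= h by rewrite -lee_fin -Nh Lnorm_ge0.
have hr : h <= r by rewrite -lee_fin -Nh.
have half := integral_truncated_sqr_ge _ _ _ mu (fun x => f x - fstar x) _ _ _ _
  e0 C0 r0 (introT andP (conj h0 hr)) (measurable_funB (mF _ Ff) (mF _ Fs)) Nh.
have {half} := half (_ : ('N[mu]_((2 + eps)%:E)[_] <= _)%E).
rewrite -Nh => /(_ (normEq _ Ff)).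
set I := (\int[mu]_(x in _) _)%E => hI.
have [e Ee] : exists e, excess_risk P delta fstar f = e%:E.
  exists (fine (excess_risk P delta fstar f)); rewrite fineK //.
  exact: (integrable_fin_num measurableT (integrableB measurableT (intF _ Ff) (intF _ Fs))).
rewrite Nh Ee expe2 -!EFinM lee_fin.
(* One factor 1/2 comes from the Taylor weight and the other from truncation; together they produce
   the constant 4. *)
have key l : 0 < l -> l < alpha -> l <= 1 -> (alpha - l) / 2 * (h ^+ 2 / 2) <= e.
  move=> l0 la l1.
  have Fl : F (fun x => l * f x + (1 - l) * fstar x).
    by apply: convF => //; rewrite (ltW l0).
  rewrite -lee_fin -Ee EFinM.
  have := excess_risk_ge P mu K fstar f delta alpha l _ d0 l0 (ltW la) l1
    (mF _ Fs) (mF _ Ff) PK (intF _ Ff) (intF _ Fs) (intF _ Fl) (opt _ Fl) H.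
  apply: le_trans; apply: lee_wpmul2l => //.
  by rewrite lee_fin divr_ge0 // subr_ge0 ltW.
suff : alpha * h ^+ 2 <= 4 * e.
  by rewrite mulrAC ler_pdivlMr // mulrC expr2.
apply/ler_addgt0Pr => s s0.
(* The three terms ensure [l <= 1], [l < alpha] and [l * h ^+ 2 <= s], so [key] yields
   [alpha * h ^+ 2 <= 4 * e + s]. The added 1 keeps the denominator positive when [h] vanishes. *)
pose l := Num.min 1 (Num.min (alpha / 2) (s / (h ^+ 2 + 1))).
have q0 : 0 < h ^+ 2 + 1 by rewrite ltr_wpDl // sqr_ge0.
have l0 : 0 < l by rewrite /l !lt_min ltr01 !divr_gt0.
have la : l < alpha by rewrite /l !gt_min; apply/orP; right; apply/orP; left; lra.
have l1 : l <= 1 by rewrite /l ge_min lexx.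
have ls : l * (h ^+ 2 + 1) <= s by rewrite -ler_pdivlMr // /l !ge_min lexx !orbT.
by have := key l l0 la l1; nra.
Qed.
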